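(* Let $k\geq 1$ be an integer, and let $\mathcal{S}_k$ be the real vector space of vector fields $p=(p_1,p_2,p_3)$ whose components are homogeneous polynomials of degree $k$ in $\boldsymbol{x}=(x_1,x_2,x_3)$ (zero included) and which satisfy $p(\boldsymbol{x})\cdot\boldsymbol{x}=0$ identically. Then the following collection of vector functions forms a basis of $\mathcal{S}_k$: for all integers $\alpha,\beta$ with $1\leq\beta\leq k$ and $1\leq\alpha\leq k+1-\beta$, the two vector functions $$\begin{bmatrix} -x_1^{\alpha-1}x_2^{k-\alpha-\beta+2}x_3^{\beta-1}\\ x_1^{\alpha}x_2^{k-\alpha-\beta+1}x_3^{\beta-1}\\ 0\end{bmatrix},\qquad \begin{bmatrix} -x_1^{k-\alpha-\beta+1}x_2^{\beta-1}x_3^{\alpha}\\ 0\\ x_1^{k-\alpha-\beta+2}x_2^{\beta-1}x_3^{\alpha-1}\end{bmatrix},$$ together with, for all integers $\alpha$ with $1\leq\alpha\leq k$, the vector function $$\begin{bmatrix} 0\\ -x_2^{\alpha-1}x_3^{k-\alpha+1}\\ x_2^{\alpha}x_3^{k-\alpha}\end{bmatrix}.$$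
   Context: Polynomials have real coefficients and are in the three variables $x_1,x_2,x_3$. Write $\tilde{\mathcal{P}}_k$ for the space of homogeneous polynomials of total degree $k$ (including the zero polynomial), and $[\tilde{\mathcal{P}}_k]^3=\tilde{\mathcal{P}}_k\times\tilde{\mathcal{P}}_k\times\tilde{\mathcal{P}}_k$. Then $\mathcal{S}_k=\{p\in[\tilde{\mathcal{P}}_k]^3 : p(\boldsymbol{x})\cdot\boldsymbol{x}=0\}$, where $p(\boldsymbol{x})\cdot\boldsymbol{x}=x_1p_1+x_2p_2+x_3p_3$. This is the three-dimensional case. *)

(* Defs.v *)
From HB Require Import structures.
From mathcomp Require Import all_boot all_order all_algebra.
From mathcomp Require Import reals.
From mathcomp Require Import mpoly.

Set Implicit Arguments.
Unset Strict Implicit.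
Unset Printing Implicit Defensive.

Import GRing.Theory.
Local Open Scope ring_scope.

Definition x1 (R : realType) : {mpoly R[3]} := 'X_(@Ordinal 3 0 isT).
Definition x2 (R : realType) : {mpoly R[3]} := 'X_(@Ordinal 3 1 isT).
Definition x3 (R : realType) : {mpoly R[3]} := 'X_(@Ordinal 3 2 isT).

Definition polyfield (R : realType) : Type :=
  ({mpoly R[3]} * {mpoly R[3]} * {mpoly R[3]})%type.

(* [dhomog 3 R k] is the subtype of the k-homogeneous polynomials, 0 included;
   unlike {mpoly R[3]} it is finite-dimensional, so this is a vectType. *)
Definition homfield (R : realType) (k : nat) : vectType R :=
  (dhomog 3 R k * dhomog 3 R k * dhomog 3 R k)%type.

Definition polyfield_of (R : realType) (k : nat) (p : homfield R k) :
    polyfield R :=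
  (mpoly_of_dhomog p.1.1, mpoly_of_dhomog p.1.2, mpoly_of_dhomog p.2).

Definition dot_x (R : realType) (p : polyfield R) : {mpoly R[3]} :=
  x1 R * p.1.1 + x2 R * p.1.2 + x3 R * p.2.

Lemma dot_x_homog (R : realType) (k : nat) (p : homfield R k) :
  dot_x (polyfield_of p) \is k.+1.-homog.
Proof.
have hM i (q : dhomog 3 R k) : 'X_i * (q : {mpoly R[3]}) \is k.+1.-homog.
  apply: (@dhomogM _ _ _ 1%N _ k); last exact: dhomog_is_dhomog.
  by rewrite dhomogX /= mdeg1.
by apply: dhomogD; [apply: dhomogD|]; apply: hM.
Qed.

Definition hom_dot_x (R : realType) (k : nat) (p : homfield R k) :
  dhomog 3 R k.+1 := DHomog (dot_x_homog p).

Lemma hom_dot_x_is_linear (R : realType) (k : nat) : linear (@hom_dot_x R k).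
Proof.
move=> c p q; apply: val_inj; rewrite /= /dot_x /=.
by rewrite !mulrDr -!scalerAr !scalerDr [RHS]addrACA [in RHS](addrACA (c *: _)).
Qed.

HB.instance Definition _ (R : realType) (k : nat) :=
  GRing.isLinear.Build R (homfield R k) (dhomog 3 R k.+1) _ (@hom_dot_x R k)
    (@hom_dot_x_is_linear R k).

Definition Sk (R : realType) (k : nat) : {vspace homfield R k} :=
  lker (linfun (@hom_dot_x R k)).

Lemma mem_Sk (R : realType) (k : nat) (p : homfield R k) :
  (p \in Sk R k) = (dot_x (polyfield_of p) == 0).
Proof. by rewrite memv_ker lfunE. Qed.

(* The subtractions below are exact on the index ranges of [basis_fields]. *)
Definition field12 (R : realType) (k a b : nat) : polyfield R :=
  (- (x1 R ^+ (a - 1) * x2 R ^+ (k + 2 - a - b) * x3 R ^+ (b - 1)),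
   x1 R ^+ a * x2 R ^+ (k + 1 - a - b) * x3 R ^+ (b - 1),
   0).

Definition field13 (R : realType) (k a b : nat) : polyfield R :=
  (- (x1 R ^+ (k + 1 - a - b) * x2 R ^+ (b - 1) * x3 R ^+ a),
   0,
   x1 R ^+ (k + 2 - a - b) * x2 R ^+ (b - 1) * x3 R ^+ (a - 1)).

Definition field23 (R : realType) (k a : nat) : polyfield R :=
  (0,
   - (x2 R ^+ (a - 1) * x3 R ^+ (k + 1 - a)),
   x2 R ^+ a * x3 R ^+ (k - a)).

Definition basis_fields (R : realType) (k : nat) : seq (polyfield R) :=
  [seq field12 R k a b | b <- iota 1 k, a <- iota 1 (k + 1 - b)] ++
  [seq field13 R k a b | b <- iota 1 k, a <- iota 1 (k + 1 - b)] ++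
  [seq field23 R k a | a <- iota 1 k].

(* Main.v *)
(* Each field of the family carries a monomial with coefficient 1 that occurs
   in the same component of no other field: for the first two kinds it is
   divisible by x1 and lies in the second, respectively third, component; for
   the third kind it is free of x1 and lies in the third component. Reading off
   these coefficients gives a family of linear forms dual to the fields, whence
   independence. For spanning, let p in S_k be killed by all these forms. Then
   p2 is free of x1 and p3 is a multiple of x3^k, so the x1-free part of
   x1 p1 + x2 p2 + x3 p3 = 0 reads x2 p2 + x3 p3 = 0; hence p3 = 0 (compare the
   x2-free parts), then p2 = 0, and finally p1 = 0. *)
Require Import Defs.
From mathcomp Require Import all_boot all_order all_algebra.
From mathcomp Require Import reals.
From mathcomp Require Import mpoly.
From mathcomp Require Import zify.

Set Implicit Arguments.
Unset Strict Implicit.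
Unset Printing Implicit Defensive.

Import GRing.Theory.
Local Open Scope ring_scope.

(** * Linear algebra: bases from dual families of linear forms *)

(** By duality [phi i] reads off the coefficient of [e i] in any combination, so a vanishing
    combination has zero coefficients. Subtracting from [v] the combination with coefficients
    [phi j v] leaves an element of [U] killed by every form, hence zero. *)
Lemma basis_of_dual (K : fieldType) (V : vectType K) (U : {vspace V})
    (I : eqType) (s : seq I) (e : I -> V) (phi : I -> V -> K) :
    uniq s -> (forall i, scalar (phi i)) ->
    {in s, forall i, e i \in U} ->
    {in s &, forall i j, phi i (e j) = (i == j)%:R} ->
    (forall v, v \in U -> {in s, forall i, phi i v = 0} -> v = 0) ->
  basis_of U (map e s).
Proof.
move=> s_uniq phi_lin eU dual total.
have phi_sum i (J : eqType) (r : seq J) (c : J -> K) (v : J -> V) :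
    phi i (\sum_(j <- r) c j *: v j) = \sum_(j <- r) c j * phi i (v j).
  elim: r => [|j r IHr]; last by rewrite !big_cons phi_lin IHr.
  (* Linearity with scalar -1 and two zero vectors gives [phi i 0 = 0]. *)
  by have := phi_lin i (-1) 0 0; rewrite !big_nil scaler0 addr0 mulN1r addNr.
have dual_sum (c : I -> K) : {in s, forall i,
    phi i (\sum_(j <- s) c j *: e j) = c i}.
  move=> i si; rewrite phi_sum (bigD1_seq i) //= dual // eqxx mulr1.
  rewrite big_seq_cond big1 ?addr0 // => j /andP[sj ji].
  by rewrite dual // eq_sym (negPf ji) mulr0.
have sumU (c : I -> K) : \sum_(j <- s) c j *: e j \in U.
  by rewrite big_seq memv_suml // => j sj; rewrite memvZ // eU.
rewrite /basis_of eqEsubv; apply/andP; split; first (apply/andP; split).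
- by apply/span_subvP => _ /mapP[i si ->]; apply: eU.
- apply/subvP => v vU.
  have /eqP : v - \sum_(j <- s) phi j v *: e j = 0.
    apply: total => [|i si]; first by rewrite rpredB.
    rewrite -[v - _]addrC -scaleN1r phi_lin (dual_sum (phi^~ v)) //.
    by rewrite mulN1r addNr.
  rewrite subr_eq0 => /eqP ->; rewrite big_seq memv_suml // => j sj.
  by rewrite memvZ // memv_span // map_f.
- rewrite -[map e s]/(tval (in_tuple (map e s))); apply/freeP => c.
  (* An empty family is free since there are no positions; otherwise [i0] serves as the default of
     [nth]. *)
  case: s => [|i0 s'] in s_uniq eU dual total dual_sum sumU c *.
    by move=> _ [].
  set s := i0 :: s' in s_uniq eU dual total dual_sum sumU c *.
  have sz : size s = size (map e s) by rewrite size_map.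
  move=> c0 i.
  have lt_i : (i < size s)%N by rewrite sz.
  (* Moves coefficients from positions to elements of [s]; as [s] is duplicate-free, [index] inverts
     [nth], and the default [i] is never reached. *)
  pose c' j := c (insubd i (index j s)).
  have <- : phi (nth i0 s i) (\sum_(j <- s) c' j *: e j) = c i.
    rewrite dual_sum ?mem_nth // /c' index_uniq //.
    by congr c; apply: val_inj; rewrite val_insubd ltn_ord.
  suff -> : \sum_(j <- s) c' j *: e j = 0.
    by have := phi_sum (nth i0 s i) I [::] (fun=> 0) e; rewrite !big_nil.
  rewrite -[RHS]c0 (big_nth i0) big_mkord.
  rewrite [in LHS]sz; apply: eq_bigr => j _.
  have lt_j : (j < size s)%N by rewrite sz.
  rewrite (nth_map i0) // /c' index_uniq //; congr (c _ *: _).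
  by apply: val_inj; rewrite val_insubd ltn_ord.
Qed.

(** * Coefficients of polynomials in three variables *)

Lemma mcoeffMX_nle (n : nat) (R : nzRingType) (p : {mpoly R[n]})
    (m k : 'X_{1..n}) : ~~ (m <= k)%MM -> (p * 'X_[m])@_k = 0.
Proof.
move=> nle; rewrite [p]mpolyE mulr_suml raddf_sum big1 //= => l _.
rewrite -scalerAl mcoeffZ -mpolyXD mcoeffX.
by case: eqP nle => [<-|_ _]; rewrite ?mulr0 // lem_addl.
Qed.

Section Coefficients.
Variable R : realType.
Implicit Types (p : {mpoly R[3]}) (a b c : nat).

Definition exp3 a b c : 'X_{1..3} := [multinom nth 0%N [:: a; b; c] i | i < 3].

Lemma exp3_surj (m : 'X_{1..3}) : exists a b c, m = exp3 a b c.
Proof.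
exists (m (@Ordinal 3 0 isT)), (m (@Ordinal 3 1 isT)), (m (@Ordinal 3 2 isT)).
by apply/mnmP => -[[|[|[|i]]] lti] //; rewrite mnmE /=; congr (m _);
  apply: val_inj.
Qed.

Lemma exp3_eq a b c a' b' c' :
  (exp3 a b c == exp3 a' b' c') = [&& a == a', b == b' & c == c'].
Proof.
apply/eqP/and3P => [/mnmP E | [/eqP-> /eqP-> /eqP->] //].
have := (E (@Ordinal 3 0 isT), E (@Ordinal 3 1 isT), E (@Ordinal 3 2 isT)).
by rewrite !mnmE /= => -[[-> ->] ->].
Qed.

Lemma mdeg_exp3 a b c : mdeg (exp3 a b c) = (a + b + c)%N.
Proof. by rewrite mdegE !big_ord_recl big_ord0 !mnmE /= addn0 addnA. Qed.

Lemma monomial3E a b c :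
  x1 R ^+ a * x2 R ^+ b * x3 R ^+ c = 'X_[exp3 a b c].
Proof.
rewrite mpolyXE_id !big_ord_recl big_ord0 mulr1 mulrA !mnmE /=.
by congr ('X_ _ ^+ _ * 'X_ _ ^+ _ * 'X_ _ ^+ _); apply: val_inj.
Qed.

Lemma x1M_monomial a b c : x1 R * 'X_[exp3 a b c] = 'X_[exp3 a.+1 b c].
Proof. by rewrite -!monomial3E !mulrA -exprS. Qed.

Lemma x2M_monomial a b c : x2 R * 'X_[exp3 a b c] = 'X_[exp3 a b.+1 c].
Proof. by rewrite -!monomial3E !mulrA (mulrC (x2 R)) exprS -!mulrA. Qed.

Lemma x3M_monomial a b c : x3 R * 'X_[exp3 a b c] = 'X_[exp3 a b c.+1].
Proof. by rewrite -!monomial3E mulrC exprSr mulrA. Qed.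

(** With its analogues for [x2] and [x3], turns [dot_x p = 0] into relations between coefficients of
    the components. *)
Lemma mcoeff_x1M p a b c :
  (x1 R * p)@_(exp3 a b c) = if a is a'.+1 then p@_(exp3 a' b c) else 0.
Proof.
rewrite mulrC; case: a => [|a].
  by apply: mcoeffMX_nle; apply/mnm_lepP => /(_ (@Ordinal 3 0 isT));
    rewrite !mnmE.
rewrite -(mcoeffMX p U_(@Ordinal 3 0 isT)); congr (_@__).
by apply/mnmP => -[[|[|[|i]]] lti]; rewrite !mnmE.
Qed.

Lemma mcoeff_x2M p a b c :
  (x2 R * p)@_(exp3 a b c) = if b is b'.+1 then p@_(exp3 a b' c) else 0.
Proof.
rewrite mulrC; case: b => [|b].
  by apply: mcoeffMX_nle; apply/mnm_lepP => /(_ (@Ordinal 3 1 isT));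
    rewrite !mnmE.
rewrite -(mcoeffMX p U_(@Ordinal 3 1 isT)); congr (_@__).
by apply/mnmP => -[[|[|[|i]]] lti]; rewrite !mnmE.
Qed.

Lemma mcoeff_x3M p a b c :
  (x3 R * p)@_(exp3 a b c) = if c is c'.+1 then p@_(exp3 a b c') else 0.
Proof.
rewrite mulrC; case: c => [|c].
  by apply: mcoeffMX_nle; apply/mnm_lepP => /(_ (@Ordinal 3 2 isT));
    rewrite !mnmE.
rewrite -(mcoeffMX p U_(@Ordinal 3 2 isT)); congr (_@__).
by apply/mnmP => -[[|[|[|i]]] lti]; rewrite !mnmE.
Qed.

End Coefficients.

(** * The indexed fields and their dual coefficients *)

Section Fields.
Variables (R : realType) (k : nat).

(* [inl (inl (a, b))], [inl (inr (a, b))] and [inr a] stand for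
   [field12 R k a b], [field13 R k a b] and [field23 R k a]. *)
Definition field_index : Type := (nat * nat + nat * nat + nat)%type.

Definition field_indices : seq field_index :=
  [seq inl (inl (a, b)) | b <- iota 1 k, a <- iota 1 (k + 1 - b)] ++
  [seq inl (inr (a, b)) | b <- iota 1 k, a <- iota 1 (k + 1 - b)] ++
  [seq inr a | a <- iota 1 k].

Definition index_ok (i : field_index) : bool :=
  match i with
  | inl (inl (a, b)) | inl (inr (a, b)) =>
      [&& 1 <= b, b <= k, 1 <= a & a <= k + 1 - b]%N
  | inr a => (1 <= a <= k)%N
  end.

(** Single monomials replace products of powers, so that degrees and coefficients can be read off
    the exponents. *)
Definition field_of_index (i : field_index) : polyfield R :=
  match i with
  | inl (inl (a, b)) =>
      (- 'X_[exp3 (a - 1) (k + 2 - a - b) (b - 1)],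
      'X_[exp3 a (k + 1 - a - b) (b - 1)], 0)
  | inl (inr (a, b)) =>
      (- 'X_[exp3 (k + 1 - a - b) (b - 1) a], 0,
      'X_[exp3 (k + 2 - a - b) (b - 1) (a - 1)])
  | inr a =>
      (0, - 'X_[exp3 0 (a - 1) (k + 1 - a)], 'X_[exp3 0 a (k - a)])
  end.

Definition dual_coeff (i : field_index) (p : polyfield R) : R :=
  match i with
  | inl (inl (a, b)) => p.1.2@_(exp3 a (k + 1 - a - b) (b - 1))
  | inl (inr (a, b)) => p.2@_(exp3 (k + 2 - a - b) (b - 1) (a - 1))
  | inr a => p.2@_(exp3 0 a (k - a))
  end.

(** [indhomog] returns a default on a component that is not [k]-homogeneous; [homfield_ofK] excludes
    this for admissible indices. *)
Definition homfield_of (p : polyfield R) : homfield R k :=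
  (indhomog k p.1.1, indhomog k p.1.2, indhomog k p.2).

Lemma map_field_of_index :
  map field_of_index field_indices = basis_fields R k.
Proof.
rewrite /field_indices !map_cat !map_flatten -!map_comp.
congr (flatten _ ++ (flatten _ ++ _)); last 1 first.
- by apply: eq_map => a; rewrite /= -!monomial3E !expr0 !mul1r.
- apply: eq_map => b /=; rewrite -map_comp; apply: eq_map => a.
  by rewrite /= -!monomial3E.
- apply: eq_map => b /=; rewrite -map_comp; apply: eq_map => a.
  by rewrite /= -!monomial3E.
Qed.

Lemma mem_field_indices i : (i \in field_indices) = index_ok i.
Proof.
rewrite !mem_cat; apply/idP/idP.
  case/or3P => [/allpairsPdep[b [a [+ + ->]]]|/allpairsPdep[b [a [+ + ->]]]|
    /mapP[a + ->]]; rewrite !mem_iota /=; lia.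
case: i => [[[a b]|[a b]]|a] /= ok; apply/or3P.
- apply: Or31; apply/allpairsPdep; exists b, a.
  by rewrite !mem_iota; split=> //; lia.
- apply: Or32; apply/allpairsPdep; exists b, a.
  by rewrite !mem_iota; split=> //; lia.
- by apply: Or33; apply/mapP; exists a => //; rewrite mem_iota; lia.
Qed.

Lemma field_indices_uniq : uniq field_indices.
Proof.
rewrite !cat_uniq; apply/and5P; split.
- by apply: allpairs_uniq_dep => [|b _|[b a] [b' a'] _ _ [-> ->]];
    rewrite ?iota_uniq.
- apply/hasPn => i; rewrite mem_cat =>
    /orP[/allpairsPdep[b [a [_ _ ->]]]|/mapP[a _ ->]];
    by apply/allpairsPdep => -[? [? []]].
- by apply: allpairs_uniq_dep => [|b _|[b a] [b' a'] _ _ [-> ->]];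
    rewrite ?iota_uniq.
- by apply/hasPn => i /mapP[a _ ->]; apply/allpairsPdep => -[? [? []]].
- by rewrite map_inj_uniq ?iota_uniq // => a a' [].
Qed.

Lemma homfield_ofK i : index_ok i ->
  polyfield_of (homfield_of (field_of_index i)) = field_of_index i.
Proof.
move=> ok.
suff [h1 h2 h3] : [/\ (field_of_index i).1.1 \is k.-homog,
    (field_of_index i).1.2 \is k.-homog & (field_of_index i).2 \is k.-homog].
  rewrite /polyfield_of /= /indhomog !val_insubd h1 h2 h3.
  by rewrite -!surjective_pairing.
case: i ok => [[[a b]|[a b]]|a] /= ok; split;
  rewrite ?dhomogN ?dhomog0 ?dhomogX //= ?mdeg_exp3; lia.
Qed.

(** The two nonzero products are the same monomial with opposite signs. *)
Lemma dot_x_field i : index_ok i -> dot_x (field_of_index i) = 0.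
Proof.
by case: i => [[[a b]|[a b]]|a] /= ok; rewrite /dot_x /= !mulrN ?mulr0
    ?x1M_monomial ?x2M_monomial ?x3M_monomial ?addr0 ?add0r addrC;
  apply/eqP; rewrite subr_eq0; apply/eqP; congr 'X_[exp3 _ _ _]; lia.
Qed.

(** Within one kind the exponents determine the index. Across kinds, either the component is zero or
    exactly one of the two monomials, the one from the third kind, is free of x1. *)
Lemma dual_coeff_field i j : index_ok i -> index_ok j ->
  dual_coeff i (field_of_index j) = (i == j)%:R.
Proof.
case: i => [[[a b]|[a b]]|a]; case: j => [[[a' b']|[a' b']]|a'] //= ok ok';
  rewrite ?mcoeffN ?mcoeff0 ?mcoeffX ?exp3_eq //.
- congr (_ *+ nat_of_bool _).
  by transitivity ((a == a') && (b == b')); first lia.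
- by rewrite (_ : [&& _, _ & _] = false) ?oppr0 //; lia.
- congr (_ *+ nat_of_bool _).
  by transitivity ((a == a') && (b == b')); first lia.
- by rewrite (_ : [&& _, _ & _] = false) //; lia.
- by rewrite (_ : [&& _, _ & _] = false) //; lia.
- by congr (_ *+ nat_of_bool _); transitivity (a == a'); first lia.
Qed.

Lemma dual_coeff_scalar i :
  scalar (fun v : homfield R k => dual_coeff i (polyfield_of v)).
Proof.
by case: i => [[[a b]|[a b]]|a] c p q /=; rewrite mcoeffD mcoeffZ.
Qed.

Lemma dual_coeff_total (v : homfield R k) : v \in Sk R k ->
  (forall i, index_ok i -> dual_coeff i (polyfield_of v) = 0) -> v = 0.
Proof.
rewrite mem_Sk => /eqP vS v0.
have coef_deg (p : dhomog 3 R k) a b c :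
    (a + b + c)%N != k -> (p : {mpoly R[3]})@_(exp3 a b c) = 0.
  rewrite -mdeg_exp3 => ne.
  exact: dhomog_nemf_coeff (dhomog_is_dhomog p) ne.
have dot0 a b c : (dot_x (polyfield_of v))@_(exp3 a b c) = 0.
  by rewrite vS mcoeff0.
case: v => -[p1 p2] p3 in vS v0 dot0 *.
have p2_x1 a b c : (p2 : {mpoly R[3]})@_(exp3 a.+1 b c) = 0.
  have [abc|/coef_deg//] := eqVneq (a.+1 + b + c)%N k.
  (* The index is solved from the exponents: as they sum to [k], its form reads exactly this
     coefficient. The next two claims choose theirs likewise. *)
  have ok : index_ok (inl (inl (a.+1, c.+1))) by rewrite /=; lia.
  rewrite -(v0 _ ok) /=; congr (_@_(exp3 _ _ _)); lia.
have p3_x1 a b c : (p3 : {mpoly R[3]})@_(exp3 a.+1 b c) = 0.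
  have [abc|/coef_deg//] := eqVneq (a.+1 + b + c)%N k.
  have ok : index_ok (inl (inr (c.+1, b.+1))) by rewrite /=; lia.
  rewrite -(v0 _ ok) /=; congr (_@_(exp3 _ _ _)); lia.
have p3_x2 b c : (p3 : {mpoly R[3]})@_(exp3 0 b.+1 c) = 0.
  have [bc|] := eqVneq (b.+1 + c)%N k; last by move=> ?; apply: coef_deg.
  have ok : index_ok (inr b.+1) by rewrite /=; lia.
  rewrite -(v0 _ ok) /=; congr (_@_(exp3 _ _ _)); lia.
have coeffs0 (p : dhomog 3 R k) :
    (forall a b c, (p : {mpoly R[3]})@_(exp3 a b c) = 0) -> p = 0.
  move=> pcoef0; apply: val_inj; apply/mpolyP => m /=.
  by have [a [b [c ->]]] := exp3_surj m; rewrite pcoef0 mcoeff0.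
have p30 : p3 = 0.
  apply: coeffs0 => -[|a] b c //; case: b => [|b] //.
  (* Only the power of x3 is left in [p3]; the products with x1 and x2 do not contribute to the
     coefficient of a pure power of x3. *)
  have := dot0 0 0 c.+1.
  by rewrite !mcoeffD mcoeff_x1M mcoeff_x2M mcoeff_x3M !add0r.
have p20 : p2 = 0.
  (* At x1-exponent 0 the product with [p1] drops out, and [p3] is already zero. *)
  apply: coeffs0 => -[|a] b c //; have := dot0 0 b.+1 c.
  rewrite !mcoeffD mcoeff_x1M mcoeff_x2M mcoeff_x3M p30 /= add0r.
  by case: c => [|c]; rewrite ?mcoeff0 addr0.
have p10 : p1 = 0.
  apply: coeffs0 => a b c; have := dot0 a.+1 b c.
  by rewrite !mcoeffD mcoeff_x1M p20 p30 /= !mulr0 mcoeff0 !addr0.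
by rewrite p10 p20 p30.
Qed.

End Fields.

(** * Assembly of the basis *)

Theorem proposition3p1 (R : realType) (k : nat) (hk : (1 <= k)%N) :
  exists2 X : seq (homfield R k),
    map (@polyfield_of R k) X = basis_fields R k & basis_of (Sk R k) X.
Proof.
exists [seq homfield_of k (field_of_index R k i) | i <- field_indices k].
  rewrite -map_field_of_index -map_comp; apply/eq_in_map => i.
  by rewrite mem_field_indices; apply: homfield_ofK.
apply: (basis_of_dual (phi := fun i v => dual_coeff k i (polyfield_of v))).
- exact: field_indices_uniq.
- exact: dual_coeff_scalar.
- move=> i; rewrite mem_field_indices => ok.
  by rewrite mem_Sk homfield_ofK // dot_x_field.
- move=> i j; rewrite !mem_field_indices => ok_i ok_j.
  by rewrite homfield_ofK // dual_coeff_field.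
- move=> v vS v0; apply: dual_coeff_total => // i ok.
  by apply: v0; rewrite mem_field_indices.
Qed.
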